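(* Let \(\Pi\) be a derivation of a simple formula \(A\) in the system \(\mathrm{HA}+\mathrm{EM}_1\) described in the context. Assume that (1) \(\Pi\) has no principal branch with a head-cut or a non-normal term; (2) \(\Pi\) contains no free term variable; (3) \(\Pi\) has no open assumptions. Then \(\Pi\) is either atomic (only atomic formulas occur in it) or ends with an \(\exists\)-introduction rule instance. In particular, if \(\Pi\) is closed (no free term variables and no open assumptions), has no principal branch with a head-cut or a non-normal term, and \(A\) is simply existential, then \(\Pi\) ends with an introduction rule instance.
   Context: The system \(\mathrm{HA}+\mathrm{EM}_1\) is a natural deduction system for first-order Heyting arithmetic. Language: variables for natural numbers, a function symbol for every primitive recursive function (including \(0\) and successor \(S\)), the equality predicate, and the \(0\)-ary predicate \(\bot\) (never true); \(\neg A\) abbreviates \(A \to \bot\). Terms are reduced by the defining equations of the primitive recursive functions oriented left to right; a term is normal if no such reduction applies to it; closed normal terms are numerals \(S^n(0)\), and formulas are identified when they have the same normal form. Rules: the usual introduction and elimination rule for each of \(\land, \lor, \to, \forall, \exists\) (minimal logic, with discharge of assumptions); atomic rules, i.e. a recursive, sound set of rules whose premisses and conclusion are atomic, which do not discharge assumptions nor bind variables, containing the equality rules, ex falso \(\bot / P\) for atomic \(P\), \(S(x)=0/\bot\), \(S(x)=S(y)/x=y\), and, for every closed atomic \(P\), the axiom \(/P\) if \(P\) is true and the rule \(P/\bot\) if \(P\) is false; the induction rule Ind: from \(A[0/x]\) and a derivation of \(A[S(x)/x]\) from the discharged assumption \(A\), conclude \(A[t/x]\) (\(t\) is the main term); and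 the rule \(\mathrm{EM}_1\): for an atomic formula \(P\), from a derivation of \(C\) from the discharged assumption \(\forall x P\) (the universal assumption) and a derivation of \(C\) from the discharged assumption \(\neg P[y/x]\) (the existential assumption), where \(y\) does not occur in \(C\) nor in open assumptions other than \(\neg P[y/x]\), conclude \(C\). Ind and \(\mathrm{EM}_1\) are counted as neither introduction nor elimination rules. In an elimination rule the major premiss is the one containing the eliminated connective/quantifier, displayed leftmost; for \(\mathrm{EM}_1\) the leftmost premiss is the major one. Derivations are trees of formula occurrences. A rule instance binds a term variable as follows: \(\forall\)I binds its quantified variable in the derivation of its premiss; \(\exists\)E binds its eigenvariable in the derivation of its rightmost premiss; Ind binds \(x\) in the derivation of its rightmost premiss; \(\mathrm{EM}_1\) binds \(y\) in the derivation of its rightmost premiss. A term variable is free in a derivation if it occurs free in some formula occurrence and is not bound by any rule instance. A branch of a derivation \(\Pi\) is a sequence of formula occurrences \(\mathfrak{a}_0,\dotsc,\mathfrak{a}_n\) such that \(\mathfrak{a}_0\) is an assumption or the conclusion of an atomic axiom, \(\mathfrak{a}_i\) is a premiss and \(\mathfrak{a}_{i+1}\) the conclusion of one rule instance, and \(\mathfrak{a}_n\) is the conclusion of \(\Pi\). It is principal if whenever \(\mathfrak{a}_i\) is a premiss of an elimination or \(\mathrm{EM}_1\) rule instance, it is its major (leftmost) premiss. A principal branch has a non-normal term if some formula occurrence on it contains a non-normal term. The head-cut of a principal branch \(\mathfrak{a}_0,\dotsc,\mathfrak{a}_n\) is the \(\mathfrak{a}_i\) with maximal \(i\) such that one of the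 following holds (if such \(i\) exists, there is a head-cut along the branch): (a) \(\mathfrak{a}_i\) is the conclusion of an elimination rule instance whose major premiss \(\mathfrak{a}_{i-1}\) is the conclusion of an introduction rule instance, and when the latter is a \(\land\)I instance, \(\mathfrak{a}_{i-2}\) is an occurrence of the same formula as \(\mathfrak{a}_i\); (b) \(\mathfrak{a}_i\) is the conclusion of an Ind instance whose main term is \(0\) or \(S(s)\) for some term \(s\); (c) \(\mathfrak{a}_i\) is the conclusion of an \(\mathrm{EM}_1\) instance \(r\) and either \(\mathfrak{a}_{i-1}\) is derived without using the assumption discharged by \(r\), or \(\mathfrak{a}_0\) is an occurrence of the universal assumption discharged by \(r\) and \(\mathfrak{a}_1\) is an occurrence of a closed atomic formula; (d) \(\mathfrak{a}_i\) is the conclusion of an elimination rule instance and \(\mathfrak{a}_{i-1}\) is the conclusion of an \(\mathrm{EM}_1\) instance. A formula is simply existential if it is \(\exists x P\) with \(P\) atomic; it is simple if it is closed and either atomic or simply existential.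
   Formalization: The main term of an induction instance is counted as occurring in its conclusion, both for free term variables and for non-normal terms; otherwise a vacuous induction on ∃z(z=0) with main term a variable y would be a counterexample. *)

(* Defs.v *)
(* Stdlib only. *)
From Stdlib Require Import Arith List Relations Cantor.
From Stdlib Require Vector.
Import ListNotations.

Set Implicit Arguments.
Open Scope list_scope.

(** * Terms *)

(* One function symbol for each definition of a primitive recursive function. *)
Inductive prf : nat -> Type :=
| Zero : prf 0
| Succ : prf 1
| Proj (n : nat) (i : Fin.t n) : prf n
| Comp (m n : nat) (f : prf m) (gs : Vector.t (prf n) m) : prf n
| Rec (n : nat) (g : prf n) (h : prf (S (S n))) : prf (S n).

(* Variables range over an arbitrary type [V]: formula occurrences use [nat],
   and the body of a quantifier uses [option V], where [None] is the variable
   bound by that quantifier.  Formulas are thus taken up to renaming of bound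
   variables and substitution cannot capture. *)
Inductive term (V : Type) : Type :=
| Var (v : V)
| App (n : nat) (f : prf n) (ts : Vector.t (term V) n).
Arguments Var {V} v.
Arguments App {V n} f ts.

Definition tzero {V : Type} : term V := App Zero (Vector.nil _).
Definition tsucc {V : Type} (t : term V) : term V :=
  App Succ (Vector.cons _ t _ (Vector.nil _)).

Fixpoint tsubst {V W : Type} (s : V -> term W) (t : term V) : term W :=
  match t with
  | Var v => s v
  | App f ts => App f (Vector.map (tsubst s) ts)
  end.

Inductive toccurs {V : Type} (z : V) : term V -> Prop :=
| toccurs_var : toccurs z (Var z)
| toccurs_app (n : nat) (f : prf n) (ts : Vector.t (term V) n) (i : Fin.t n) :
    toccurs z (Vector.nth ts i) -> toccurs z (App f ts).

Inductive tred {V : Type} : term V -> term V -> Prop :=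
| tred_proj (n : nat) (i : Fin.t n) (ts : Vector.t (term V) n) :
    tred (App (Proj i) ts) (Vector.nth ts i)
| tred_comp (m n : nat) (f : prf m) (gs : Vector.t (prf n) m)
    (ts : Vector.t (term V) n) :
    tred (App (Comp f gs) ts) (App f (Vector.map (fun g => App g ts) gs))
| tred_rec_zero (n : nat) (g : prf n) (h : prf (S (S n)))
    (ts : Vector.t (term V) n) :
    tred (App (Rec g h) (Vector.cons _ tzero _ ts)) (App g ts)
| tred_rec_succ (n : nat) (g : prf n) (h : prf (S (S n))) (s : term V)
    (ts : Vector.t (term V) n) :
    tred (App (Rec g h) (Vector.cons _ (tsucc s) _ ts))
         (App h (Vector.cons _ s _
                  (Vector.cons _ (App (Rec g h) (Vector.cons _ s _ ts)) _ ts)))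
| tred_arg (n : nat) (f : prf n) (ts : Vector.t (term V) n) (i : Fin.t n)
    (t : term V) :
    tred (Vector.nth ts i) t -> tred (App f ts) (App f (Vector.replace ts i t)).

Definition tnormal {V : Type} (t : term V) : Prop := forall t', ~ tred t t'.

Definition tnf {V : Type} (t t' : term V) : Prop :=
  clos_refl_trans _ tred t t' /\ tnormal t'.

(** * Formulas *)

Inductive atom (V : Type) : Type :=
| Equal (s t : term V)
| Bot.
Arguments Equal {V} s t.
Arguments Bot {V}.

Inductive formula (V : Type) : Type :=
| Atom (P : atom V)
| And (A B : formula V)
| Or (A B : formula V)
| Imp (A B : formula V)
| All (A : formula (option V))
| Ex (A : formula (option V)).
Arguments Atom {V} P.
Arguments And {V} A B.
Arguments Or {V} A B.
Arguments Imp {V} A B.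
Arguments All {V} A.
Arguments Ex {V} A.

Definition Not {V : Type} (A : formula V) : formula V := Imp A (Atom Bot).

Definition asubst {V W : Type} (s : V -> term W) (P : atom V) : atom W :=
  match P with
  | Equal t u => Equal (tsubst s t) (tsubst s u)
  | Bot => Bot
  end.

Definition up {V W : Type} (s : V -> term W) (o : option V) : term (option W) :=
  match o with
  | None => Var None
  | Some v => tsubst (fun w => Var (Some w)) (s v)
  end.

Fixpoint fsubst {V W : Type} (s : V -> term W) (A : formula V) : formula W :=
  match A with
  | Atom P => Atom (asubst s P)
  | And B C => And (fsubst s B) (fsubst s C)
  | Or B C => Or (fsubst s B) (fsubst s C)
  | Imp B C => Imp (fsubst s B) (fsubst s C)
  | All B => All (fsubst (up s) B)
  | Ex B => Ex (fsubst (up s) B)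
  end.

Definition aoccurs {V : Type} (z : V) (P : atom V) : Prop :=
  match P with
  | Equal s t => toccurs z s \/ toccurs z t
  | Bot => False
  end.

Fixpoint foccurs {V : Type} (z : V) (A : formula V) : Prop :=
  match A with
  | Atom P => aoccurs z P
  | And B C | Or B C | Imp B C => foccurs z B \/ foccurs z C
  | All B | Ex B => foccurs (Some z) B
  end.

Fixpoint has_nonnormal_term {V : Type} (A : formula V) : Prop :=
  match A with
  | Atom (Equal s t) => ~ tnormal s \/ ~ tnormal t
  | Atom Bot => False
  | And B C | Or B C | Imp B C => has_nonnormal_term B \/ has_nonnormal_term C
  | All B | Ex B => has_nonnormal_term B
  end.

(* [fnf A A']: [A'] is a normal form of [A]. *)
Inductive fnf {V : Type} : formula V -> formula V -> Prop :=
| fnf_equal s s' t t' :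
    tnf s s' -> tnf t t' -> fnf (Atom (Equal s t)) (Atom (Equal s' t'))
| fnf_bot : fnf (Atom Bot) (Atom Bot)
| fnf_and A A' B B' : fnf A A' -> fnf B B' -> fnf (And A B) (And A' B')
| fnf_or A A' B B' : fnf A A' -> fnf B B' -> fnf (Or A B) (Or A' B')
| fnf_imp A A' B B' : fnf A A' -> fnf B B' -> fnf (Imp A B) (Imp A' B')
| fnf_all A A' : @fnf (option V) A A' -> fnf (All A) (All A')
| fnf_ex A A' : @fnf (option V) A A' -> fnf (Ex A) (Ex A').

Definition same_nf {V : Type} (A B : formula V) : Prop :=
  exists C, fnf A C /\ fnf B C.
Infix "≡" := same_nf (at level 70).

Notation fm := (formula nat).

Definition subst1 (x : nat) (t : term nat) (y : nat) : term nat :=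
  if y =? x then t else Var y.

(* [sub A t x] is A[t/x]. *)
Definition sub (A : fm) (t : term nat) (x : nat) : fm := fsubst (subst1 x t) A.

Definition abstract (x : nat) (A : fm) : formula (option nat) :=
  fsubst (fun y => Var (if y =? x then None else Some y)) A.

Definition forall_ (x : nat) (A : fm) : fm := All (abstract x A).
Definition exists_ (x : nat) (A : fm) : fm := Ex (abstract x A).

Definition is_atomic (A : fm) : Prop := exists P, A = Atom P.
Definition closed_formula (A : fm) : Prop := forall z, ~ foccurs z A.
Definition simply_existential (A : fm) : Prop := exists P, A = Ex (Atom P).
Definition simple (A : fm) : Prop :=
  closed_formula A /\ (is_atomic A \/ simply_existential A).

(** * Truth of atomic formulas *)

Fixpoint prf_eval (n : nat) (f : prf n) : Vector.t nat n -> nat :=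
  match f in prf k return Vector.t nat k -> nat with
  | Zero => fun _ => 0
  | Succ => fun v => S (Vector.hd v)
  | Proj i => fun v => Vector.nth v i
  | Comp f gs => fun v => prf_eval f (Vector.map (fun g => prf_eval g v) gs)
  | Rec g h => fun v =>
      nat_rect (fun _ => nat) (prf_eval g (Vector.tl v))
        (fun k r => prf_eval h (Vector.cons _ k _ (Vector.cons _ r _ (Vector.tl v))))
        (Vector.hd v)
  end.

Fixpoint teval (e : nat -> nat) (t : term nat) : nat :=
  match t with
  | Var x => e x
  | App f ts => prf_eval f (Vector.map (teval e) ts)
  end.

Definition asat (e : nat -> nat) (P : atom nat) : Prop :=
  match P with
  | Equal s t => teval e s = teval e t
  | Bot => False
  end.

(** * Recursive sets of atomic rules *)

(* General recursive functions, possibly partial, given by their graphs. *)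
Inductive recf : nat -> Type :=
| RZero (n : nat) : recf n
| RSucc : recf 1
| RProj (n : nat) (i : Fin.t n) : recf n
| RComp (m n : nat) (f : recf m) (gs : Vector.t (recf n) m) : recf n
| RRec (n : nat) (g : recf n) (h : recf (S (S n))) : recf (S n)
| RMu (n : nat) (f : recf (S n)) : recf n.

Inductive computes : forall n : nat, recf n -> Vector.t nat n -> nat -> Prop :=
| computes_zero n v : computes (RZero n) v 0
| computes_succ x : computes RSucc (Vector.cons _ x _ (Vector.nil _)) (S x)
| computes_proj n (i : Fin.t n) v : computes (RProj i) v (Vector.nth v i)
| computes_comp m n (f : recf m) (gs : Vector.t (recf n) m) v ws y :
    (forall i, computes (Vector.nth gs i) v (Vector.nth ws i)) ->
    computes f ws y -> computes (RComp f gs) v y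
| computes_rec_zero n (g : recf n) h v y :
    computes g v y -> computes (RRec g h) (Vector.cons _ 0 _ v) y
| computes_rec_succ n (g : recf n) h v k r y :
    computes (RRec g h) (Vector.cons _ k _ v) r ->
    computes h (Vector.cons _ k _ (Vector.cons _ r _ v)) y ->
    computes (RRec g h) (Vector.cons _ (S k) _ v) y
| computes_mu n (f : recf (S n)) v k (ys : nat -> nat) :
    (forall j, j < k -> computes f (Vector.cons _ j _ v) (S (ys j))) ->
    computes f (Vector.cons _ k _ v) 0 ->
    computes (RMu f) v k.

Definition recursive_set (X : nat -> Prop) : Prop :=
  exists f : recf 1, forall n,
    (X n /\ computes f (Vector.cons _ n _ (Vector.nil _)) 1) \/
    (~ X n /\ computes f (Vector.cons _ n _ (Vector.nil _)) 0).

(* Goedel numbering. *)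
Fixpoint code_list (l : list nat) : nat :=
  match l with
  | [] => 0
  | x :: l' => S (Cantor.to_nat (x, code_list l'))
  end.

Fixpoint code_prf (n : nat) (f : prf n) : nat :=
  match f with
  | Zero => code_list [0]
  | Succ => code_list [1]
  | @Proj n i => code_list [2; n; proj1_sig (Fin.to_nat i)]
  | @Comp m n f gs =>
      code_list [3; m; n; code_prf f;
                 code_list (Vector.to_list (Vector.map (fun g => code_prf g) gs))]
  | @Rec n g h => code_list [4; n; code_prf g; code_prf h]
  end.

Fixpoint code_term (t : term nat) : nat :=
  match t with
  | Var x => code_list [0; x]
  | @App _ n f ts =>
      code_list [1; n; code_prf f;
                 code_list (Vector.to_list (Vector.map code_term ts))]
  end.

Definition code_atom (P : atom nat) : nat :=
  match P with
  | Equal s t => code_list [0; code_term s; code_term t]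
  | Bot => code_list [1]
  end.

(* [R [P1; ...; Pk] P]: the rule with premisses P1, ..., Pk and conclusion P
   is an instance of an atomic rule. *)
Definition atomic_rules := list (atom nat) -> atom nat -> Prop.

Definition recursive_rules (R : atomic_rules) : Prop :=
  recursive_set (fun n =>
    exists Ps P, R Ps P /\ n = code_list (code_atom P :: map code_atom Ps)).

Definition sound_rules (R : atomic_rules) : Prop :=
  forall Ps P, R Ps P -> forall e, Forall (asat e) Ps -> asat e P.

Record admissible_rules (R : atomic_rules) : Prop := {
  ar_recursive : recursive_rules R;
  ar_sound : sound_rules R;
  ar_refl : forall t, R [] (Equal t t);
  ar_sym : forall s t, R [Equal s t] (Equal t s);
  ar_trans : forall s t u, R [Equal s t; Equal t u] (Equal s u);
  ar_cong : forall n (f : prf n) (ss ts : Vector.t (term nat) n),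
    R (Vector.to_list (Vector.map2 (@Equal nat) ss ts))
      (Equal (App f ss) (App f ts));
  ar_exfalso : forall P, R [Bot] P;
  ar_succ_zero : forall t, R [Equal (tsucc t) tzero] Bot;
  ar_succ_inj : forall s t, R [Equal (tsucc s) (tsucc t)] (Equal s t);
  ar_true : forall P, (forall z, ~ aoccurs z P) -> (forall e, asat e P) -> R [] P;
  ar_false : forall P, (forall z, ~ aoccurs z P) -> (forall e, ~ asat e P) ->
    R [P] Bot
}.

(** * Derivations *)

(* Assumptions carry labels in [nat]; a rule instance discharges, in a given
   premiss, the assumptions bearing its label that are still open there.  The
   discharged formulas are

     OrE u A v B      A (label u) and B (label v) in the two minor premisses;
     ImpI u A         A;
     ExE u x y A      A[y/x], where the major premiss is exists x A;
     Ind u x A t      A, in the derivation of A[S(x)/x];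
     EM1 u v x y P    forall x P (label u) on the left, and
                      ~ P[y/x] (label v) on the right. *)
Inductive rule : Type :=
| Assume (u : nat)
| Atomic
| AndI | AndE1 | AndE2
| OrI1 | OrI2 | OrE (u : nat) (A : fm) (v : nat) (B : fm)
| ImpI (u : nat) (A : fm) | ImpE
| AllI (x : nat) | AllE
| ExI | ExE (u x y : nat) (A : fm)
| Ind (u x : nat) (A : fm) (t : term nat)
| EM1 (u v x y : nat) (P : atom nat).

Definition is_intro (r : rule) : Prop :=
  match r with
  | AndI | OrI1 | OrI2 | ImpI _ _ | AllI _ | ExI => True
  | _ => False
  end.

Definition is_elim (r : rule) : Prop :=
  match r with
  | AndE1 | AndE2 | OrE _ _ _ _ | ImpE | AllE | ExE _ _ _ _ => True
  | _ => False
  end.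

Definition is_EM1 (r : rule) : Prop :=
  match r with EM1 _ _ _ _ _ => True | _ => False end.

(* Premisses are numbered from 0, from left to right. *)
Inductive tree : Type := Node (r : rule) (C : fm) (ps : list tree).

Definition root_rule (D : tree) : rule := let (r, _, _) := D in r.
Definition concl (D : tree) : fm := let (_, C, _) := D in C.
Definition premisses (D : tree) : list tree := let (_, _, ps) := D in ps.

Definition discharge (r : rule) (k : nat) : option (nat * fm) :=
  match r, k with
  | OrE u A _ _, 1 => Some (u, A)
  | OrE _ _ v B, 2 => Some (v, B)
  | ImpI u A, 0 => Some (u, A)
  | ExE u x y A, 1 => Some (u, sub A (Var y) x)
  | Ind u _ A _, 1 => Some (u, A)
  | EM1 u _ x _ P, 0 => Some (u, forall_ x (Atom P))
  | EM1 _ v x y P, 1 => Some (v, Not (sub (Atom P) (Var y) x))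
  | _, _ => None
  end.

Definition discharges (r : rule) (k u : nat) : Prop :=
  exists A, discharge r k = Some (u, A).

Definition binds (r : rule) (k z : nat) : Prop :=
  match r, k with
  | AllI x, 0 => z = x
  | ExE _ _ y _, 1 => z = y
  | Ind _ x _ _, 1 => z = x
  | EM1 _ _ _ y _, 1 => z = y
  | _, _ => False
  end.

(* [open_assumption D u A]: some leaf of [D] is the assumption [A] with label
   [u], and no rule instance of [D] discharges it. *)
Inductive open_assumption : tree -> nat -> fm -> Prop :=
| open_leaf u A : open_assumption (Node (Assume u) A []) u A
| open_premiss r C ps k d u A :
    nth_error ps k = Some d -> open_assumption d u A -> ~ discharges r k u ->
    open_assumption (Node r C ps) u A.

Definition rule_instance (R : atomic_rules) (r : rule) (ps : list fm) (C : fm)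
  : Prop :=
  match r, ps with
  | Assume _, [] => True
  | Atomic, _ =>
      exists Ps P, R Ps P /\ Forall2 same_nf ps (map Atom Ps) /\ C ≡ Atom P
  | AndI, [A; B] => C ≡ And A B
  | AndE1, [D] => exists B, D ≡ And C B
  | AndE2, [D] => exists A, D ≡ And A C
  | OrI1, [A] => exists B, C ≡ Or A B
  | OrI2, [B] => exists A, C ≡ Or A B
  | OrE _ A _ B, [D; C1; C2] => D ≡ Or A B /\ C1 ≡ C /\ C2 ≡ C
  | ImpI _ A, [B] => C ≡ Imp A B
  | ImpE, [D; A] => D ≡ Imp A C
  | AllI x, [A] => C ≡ forall_ x A
  | AllE, [D] => exists x A t, D ≡ forall_ x A /\ C ≡ sub A t x
  | ExI, [D] => exists x A t, D ≡ sub A t x /\ C ≡ exists_ x A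
  | ExE _ x _ A, [D; C1] => D ≡ exists_ x A /\ C1 ≡ C
  | Ind _ x A t, [B0; B1] =>
      B0 ≡ sub A tzero x /\ B1 ≡ sub A (tsucc (Var x)) x /\ C ≡ sub A t x
  | EM1 _ _ _ _ _, [C1; C2] => C1 ≡ C /\ C2 ≡ C
  | _, _ => False
  end.

(* The conditions on the formulas of the instance itself; those on the open
   assumptions are in [eigenvariables_ok]. *)
Definition fresh_in_instance (r : rule) (C : fm) : Prop :=
  match r with
  | ExE _ x y A => ~ foccurs y (exists_ x A) /\ ~ foccurs y C
  | EM1 _ _ x y P => ~ foccurs y (forall_ x (Atom P)) /\ ~ foccurs y C
  | _ => True
  end.

Definition eigenvariables_ok (r : rule) (C : fm) (ps : list tree) : Prop :=
  fresh_in_instance r C /\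
  forall k d z u A,
    nth_error ps k = Some d -> binds r k z ->
    open_assumption d u A -> ~ discharges r k u -> ~ foccurs z A.

Definition discharge_ok (r : rule) (ps : list tree) : Prop :=
  forall k d u A B,
    nth_error ps k = Some d -> discharge r k = Some (u, A) ->
    open_assumption d u B -> B ≡ A.

Inductive derivation (R : atomic_rules) : tree -> Prop :=
| derivation_node r C ps :
    (forall d, In d ps -> derivation R d) ->
    rule_instance R r (map concl ps) C ->
    eigenvariables_ok r C ps ->
    discharge_ok r ps ->
    derivation R (Node r C ps).

(* The main term t of an Ind instance counts as occurring in its conclusion
   A[t/x].  This matters only when t is not visible there: x not free in A, or
   t erased by normalization. *)
Definition main_term (D : tree) : option (term nat) :=
  match root_rule D with Ind _ _ _ t => Some t | _ => None end.

Definition occurs_at_root (z : nat) (D : tree) : Prop :=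
  foccurs z (concl D) \/ exists t, main_term D = Some t /\ toccurs z t.

Definition nonnormal_at_root (D : tree) : Prop :=
  has_nonnormal_term (concl D) \/
  exists t, main_term D = Some t /\ ~ tnormal t.

Inductive free_in_derivation (z : nat) : tree -> Prop :=
| free_root D : occurs_at_root z D -> free_in_derivation z D
| free_premiss r C ps k d :
    nth_error ps k = Some d -> free_in_derivation z d -> ~ binds r k z ->
    free_in_derivation z (Node r C ps).

(** * Branches *)

(* A formula occurrence is given by its position: the premiss numbers read
   upwards from the conclusion of the derivation. *)
Definition position := list nat.

Fixpoint subderivation (D : tree) (p : position) : option tree :=
  match p with
  | [] => Some D
  | k :: q =>
      match nth_error (premisses D) k with
      | Some d => subderivation d q
      | None => None
      end
  end.

(* [occ D a i d]: [d] is the subderivation of [D] ending with the i-th formula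
   occurrence of [a]. *)
Definition occ (D : tree) (a : list position) (i : nat) (d : tree) : Prop :=
  exists p, nth_error a i = Some p /\ subderivation D p = Some d.

Definition is_top (d : tree) : Prop :=
  premisses d = [] /\ (root_rule d = Atomic \/ exists u, root_rule d = Assume u).

Definition branch (D : tree) (a : list position) : Prop :=
  (exists d, occ D a 0 d /\ is_top d) /\
  (forall i p q, nth_error a i = Some p -> nth_error a (S i) = Some q ->
     exists k, p = q ++ [k]) /\
  nth_error a (length a - 1) = Some [].

Definition principal_branch (D : tree) (a : list position) : Prop :=
  branch D a /\
  forall i q k d,
    nth_error a i = Some (q ++ [k]) -> nth_error a (S i) = Some q ->
    subderivation D q = Some d ->
    is_elim (root_rule d) \/ is_EM1 (root_rule d) ->
    k = 0.

(* The formula occurrence at [p] is an assumption discharged, in premiss [k],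
   by the rule instance whose conclusion is at [q]. *)
Definition discharged_by (D : tree) (p q : position) (k : nat) : Prop :=
  exists u A d p',
    subderivation D p = Some (Node (Assume u) A []) /\
    subderivation D q = Some d /\ p = q ++ k :: p' /\
    discharges (root_rule d) k u /\
    forall p1 j p2 e, p' = p1 ++ j :: p2 ->
      subderivation D (q ++ k :: p1) = Some e -> ~ discharges (root_rule e) j u.

(* [cut_at D a i]: the i-th occurrence of the principal branch [a] satisfies
   one of the clauses in the definition of head-cut. *)
Inductive cut_at (D : tree) (a : list position) : nat -> Prop :=
| cut_detour i d e :
    occ D a (S i) d -> is_elim (root_rule d) ->
    occ D a i e -> is_intro (root_rule e) ->
    (root_rule e = AndI ->
     exists j f, i = S j /\ occ D a j f /\ concl f ≡ concl d) ->
    cut_at D a (S i)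
| cut_ind i d u x A t :
    occ D a i d -> root_rule d = Ind u x A t ->
    t = tzero \/ (exists s, t = tsucc s) ->
    cut_at D a i
| cut_EM1_unused i d e u v x y P :
    occ D a (S i) d -> root_rule d = EM1 u v x y P ->
    occ D a i e -> (forall B, ~ open_assumption e u B) ->
    cut_at D a (S i)
| cut_EM1_closed i p q d e :
    nth_error a 0 = Some p -> nth_error a (S i) = Some q ->
    subderivation D q = Some d -> is_EM1 (root_rule d) ->
    discharged_by D p q 0 ->
    occ D a 1 e -> is_atomic (concl e) -> closed_formula (concl e) ->
    cut_at D a (S i)
| cut_EM1_permute i d e :
    occ D a (S i) d -> is_elim (root_rule d) ->
    occ D a i e -> is_EM1 (root_rule e) ->
    cut_at D a (S i).

Definition head_cut (D : tree) (a : list position) (i : nat) : Prop :=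
  cut_at D a i /\ forall j, cut_at D a j -> j <= i.

Definition has_head_cut (D : tree) (a : list position) : Prop :=
  exists i, head_cut D a i.

Definition branch_has_nonnormal_term (D : tree) (a : list position) : Prop :=
  exists i d, occ D a i d /\ nonnormal_at_root d.

Definition atomic_derivation (D : tree) : Prop :=
  forall p d, subderivation D p = Some d -> is_atomic (concl d).

(* Main.v *)
(** A derivation is followed upwards from its conclusion along leftmost
    premisses of eliminations and of EM1 and along all premisses of atomic
    rules and of existential introductions.  No rule met on the way binds a
    variable in the premiss chosen, so everything stays closed and an Ind
    instance would have a numeral as main term, hence be a head-cut; and the
    only assumptions discharged are universal assumptions of EM1.  A chain of
    eliminations without head-cut can only start from such an assumption, whose
    instance is then closed and atomic: again a head-cut.  So eliminations never
    occur on the way, universal assumptions are never used, and therefore EM1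
    does not occur either. *)

From Stdlib Require Import Arith List Relations Lia.
From Stdlib Require Vector.
Require Import Defs.
Import ListNotations.

(** * Closed normal terms *)

(** The principle generated for [term] gives no hypothesis on the arguments, since they are nested
    inside a vector. *)
Lemma term_ind_nth (V : Type) (P : term V -> Prop) :
  (forall v, P (Var v)) ->
  (forall n (f : prf n) ts, (forall i, P (Vector.nth ts i)) -> P (App f ts)) ->
  forall t, P t.
Proof.
  intros HV HA.
  fix IH 1.
  intros [v | n f ts]; [apply HV | apply HA].
  clear f.
  induction ts as [| h n ts IHts]; intros i.
  - apply Fin.case0; exact i.
  - apply (Fin.caseS' i); [exact (IH h) | exact IHts].
Qed.

(** Projections and compositions are always redexes, and so is a recursion whose first argument is
    zero or a successor, which the induction on the term provides. Only [Zero] and [Succ] remain as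
    head symbols. *)
Lemma closed_normal_term (V : Type) (t : term V) :
  (forall z, ~ toccurs z t) -> tnormal t ->
  t = tzero \/ exists s, t = tsucc s.
Proof.
  induction t as [v | n f ts IH] using term_ind_nth; intros Hc Hn.
  - destruct (Hc v); constructor.
  - destruct f as [| | n i | m n f gs | n g h].
    + left; unfold tzero; f_equal.
      apply (Vector.case0 (fun v => v = Vector.nil _)); reflexivity.
    + right.
      clear IH Hc Hn; pattern ts; apply Vector.caseS'; intros s us.
      exists s; unfold tsucc; do 2 f_equal.
      apply (Vector.case0 (fun v => v = Vector.nil _)); reflexivity.
    + destruct (Hn _ (tred_proj i ts)).
    + destruct (Hn _ (tred_comp f gs ts)).
    + specialize (IH Fin.F1).
      assert (H0 : forall z, ~ toccurs z (Vector.nth ts Fin.F1)).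
      { intros z Hz; apply (Hc z); exact (toccurs_app _ _ _ Hz). }
      assert (H1 : tnormal (Vector.nth ts Fin.F1)).
      { intros t' Ht; exact (Hn _ (tred_arg _ _ _ Ht)). }
      specialize (IH H0 H1).
      clear Hc H0 H1; revert Hn IH; pattern ts; apply Vector.caseS'.
      intros t0 us Hn [H | [s H]]; simpl in H; subst t0.
      * destruct (Hn _ (tred_rec_zero g h us)).
      * destruct (Hn _ (tred_rec_succ g h s us)).
Qed.

(** * Logical shape and normal forms of formulas *)

(** The logical skeleton, with all terms erased. It is invariant under substitution and under [≡],
    so it separates connectives without computing normal forms. *)
Inductive shape : Type :=
| SAtom
| SAnd (s t : shape)
| SOr (s t : shape)
| SImp (s t : shape)
| SAll (s : shape)
| SEx (s : shape).

Fixpoint shape_of {V : Type} (A : formula V) : shape :=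
  match A with
  | Atom _ => SAtom
  | And B C => SAnd (shape_of B) (shape_of C)
  | Or B C => SOr (shape_of B) (shape_of C)
  | Imp B C => SImp (shape_of B) (shape_of C)
  | All B => SAll (shape_of B)
  | Ex B => SEx (shape_of B)
  end.

Lemma shape_fsubst (V : Type) (A : formula V) :
  forall (W : Type) (s : V -> term W), shape_of (fsubst s A) = shape_of A.
Proof. induction A; intros W s; simpl; congruence. Qed.

Lemma shape_sub (A : fm) (t : term nat) (x : nat) :
  shape_of (sub A t x) = shape_of A.
Proof. apply shape_fsubst. Qed.

Lemma shape_abstract (x : nat) (A : fm) : shape_of (abstract x A) = shape_of A.
Proof. apply shape_fsubst. Qed.

Lemma shape_fnf (V : Type) (A B : formula V) : fnf A B -> shape_of A = shape_of B.
Proof. induction 1; simpl; congruence. Qed.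

Lemma shape_same_nf (V : Type) (A B : formula V) : A ≡ B -> shape_of A = shape_of B.
Proof.
  intros [C [HA HB]].
  apply shape_fnf in HA; apply shape_fnf in HB; congruence.
Qed.

Lemma shape_atomic (A : fm) : shape_of A = SAtom -> is_atomic A.
Proof. destruct A; try discriminate; intros _; eexists; reflexivity. Qed.

(** [~ has_nonnormal_term] yields normality only up to double negation; this suffices, because a
    first reduction step is to be refuted. *)
Lemma tnf_normal (V : Type) (t t' : term V) : ~ ~ tnormal t -> tnf t t' -> t' = t.
Proof.
  intros Hn [Ht _].
  apply clos_rt_rt1n in Ht; destruct Ht as [| u v Hu _]; [reflexivity |].
  destruct Hn; intros Hn; exact (Hn _ Hu).
Qed.

Lemma fnf_normal (V : Type) (A B : formula V) :
  fnf A B -> ~ has_nonnormal_term A -> B = A.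
Proof.
  induction 1; simpl; intros Hn; try (f_equal; tauto).
  do 2 f_equal; apply tnf_normal; tauto.
Qed.

(** A normal [C] is its only normal form, so both conjunctions reduce to [C] itself; this avoids an
    appeal to confluence of [tred]. *)
Lemma same_nf_And_inv (V : Type) (A B C A' B' : formula V) :
  ~ has_nonnormal_term C -> C ≡ And A B -> C ≡ And A' B' -> A ≡ A' /\ B ≡ B'.
Proof.
  intros Hn [E [HC HE]] [E' [HC' HE']].
  apply fnf_normal in HC; [| exact Hn]; apply fnf_normal in HC'; [| exact Hn].
  subst E E'.
  inversion HE; subst; inversion HE'; subst; split; eexists; eauto.
Qed.

(** * Principal branches *)

Lemma subderivation_app (D : tree) (p q : position) :
  subderivation D (p ++ q) =
  match subderivation D p with Some d => subderivation d q | None => None end.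
Proof.
  revert D; induction p as [| k p IH]; intros D; simpl; [reflexivity |].
  destruct (nth_error (premisses D) k); auto.
Qed.

Lemma snoc_eq_app_cons (T : Type) (q q0 r : list T) (k j : T) :
  q ++ [k] = q0 ++ j :: r ->
  (q = q0 /\ k = j /\ r = []) \/ exists r', r = r' ++ [k] /\ q = q0 ++ j :: r'.
Proof.
  destruct r as [| x r' _] using rev_ind; intros H.
  - apply app_inj_tail in H; left; tauto.
  - change (q0 ++ j :: r' ++ [x]) with (q0 ++ (j :: r') ++ [x]) in H.
    rewrite app_assoc in H; apply app_inj_tail in H as [-> ->].
    right; eauto.
Qed.

(** Principality for a path that may not yet have reached a top occurrence. *)
Definition principal_path (D : tree) (p : position) : Prop :=
  forall q k r d, p = q ++ k :: r -> subderivation D q = Some d ->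
    is_elim (root_rule d) \/ is_EM1 (root_rule d) -> k = 0.

Lemma principal_path_snoc (D : tree) (p : position) (k : nat) (d : tree) :
  principal_path D p -> subderivation D p = Some d ->
  (is_elim (root_rule d) \/ is_EM1 (root_rule d) -> k = 0) ->
  principal_path D (p ++ [k]).
Proof.
  intros Hp Hd Hk q j r e Heq He Hr.
  apply snoc_eq_app_cons in Heq as [(-> & -> & ->) | (r' & -> & ->)].
  - rewrite Hd in He; injection He as ->; auto.
  - eapply Hp; eauto.
Qed.

Lemma subderivation_snoc (D : tree) (p : position) (k : nat) (d e : tree) :
  subderivation D p = Some d -> nth_error (premisses d) k = Some e ->
  subderivation D (p ++ [k]) = Some e.
Proof. intros Hd He; rewrite subderivation_app, Hd; simpl; now rewrite He. Qed.

(** The branch from the occurrence at [p] down to the conclusion: all prefixes of [p], longest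
    first. Index [i] is thus the distance from the top. *)
Definition descent (p : position) : list position :=
  map (fun i => firstn (length p - i) p) (seq 0 (S (length p))).

Lemma nth_error_descent (p : position) (i : nat) (q : position) :
  nth_error (descent p) i = Some q <-> exists r, p = q ++ r /\ length r = i.
Proof.
  unfold descent; rewrite nth_error_map, nth_error_seq.
  destruct (Nat.ltb_spec i (S (length p))) as [Hi | Hi]; simpl; split.
  - intros [= <-]; exists (skipn (length p - i) p).
    rewrite firstn_skipn, length_skipn; split; [reflexivity | lia].
  - intros [r [-> <-]]; f_equal.
    rewrite length_app, Nat.add_sub, firstn_app, Nat.sub_diag, firstn_all.
    apply app_nil_r.
  - discriminate.
  - intros [r [-> <-]]; rewrite length_app in Hi; lia.
Qed.

Lemma nth_error_descent_app (q r : position) :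
  nth_error (descent (q ++ r)) (length r) = Some q.
Proof. apply nth_error_descent; eauto. Qed.

Lemma principal_branch_descent (D : tree) (p : position) (d : tree) :
  principal_path D p -> subderivation D p = Some d -> is_top d ->
  principal_branch D (descent p).
Proof.
  intros Hp Hd Ht; repeat split.
  - exists d; split; [| exact Ht].
    exists p; split; [| exact Hd].
    apply nth_error_descent; exists []; rewrite app_nil_r; auto.
  - intros i q q' Hq Hq'.
    apply nth_error_descent in Hq as [r [-> Hr]].
    apply nth_error_descent in Hq' as [r' [Heq Hr']].
    destruct r' as [| k r']; [discriminate |].
    exists k.
    injection Hr' as Hr'.
    replace (q' ++ k :: r') with ((q' ++ [k]) ++ r') in Heq
      by now rewrite <- app_assoc.
    (* [r] and [r'] have equal length, so the overlap [l] is empty. *)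
    apply app_eq_app in Heq as [l [[-> ->] | [Hl ->]]];
      rewrite length_app in *; destruct l; simpl in *; try lia;
      now rewrite app_nil_r in *.
  - replace (length (descent p) - 1) with (length p).
    + apply nth_error_descent; exists p; auto.
    + unfold descent; rewrite length_map, length_seq; lia.
  - intros i q k e Hi _ He Hr.
    apply nth_error_descent in Hi as [r [-> _]].
    eapply Hp; [| exact He | exact Hr].
    rewrite <- app_assoc; reflexivity.
Qed.

(** Leftmost premisses are always allowed on a principal path; following them ends at an instance
    without premisses, which must be an assumption or an atomic axiom. *)
Lemma principal_top (R : atomic_rules) (D d : tree) :
  derivation R d ->
  forall q, principal_path D q -> subderivation D q = Some d ->
  exists r e, principal_path D (q ++ r) /\ subderivation D (q ++ r) = Some e /\
    is_top e.
Proof.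
  induction 1 as [r C ps _ IH Hr _ _]; intros q Hq Hd.
  destruct ps as [| d ps].
  - exists [], (Node r C []); rewrite app_nil_r; repeat split; auto.
    destruct r; simpl in Hr; try contradiction; simpl; eauto.
  - destruct (IH d (or_introl eq_refl) (q ++ [0])) as (s & e & H1 & H2 & H3).
    + eapply principal_path_snoc; eauto.
    + eapply subderivation_snoc; eauto; reflexivity.
    + rewrite <- app_assoc in H1, H2; eauto.
Qed.

(** * Exploiting the absence of head-cuts *)

Lemma cut_at_bound (D : tree) (a : list position) (i : nat) :
  cut_at D a i -> i < length a.
Proof.
  intros H; apply nth_error_Some.
  destruct H as [i d e [p [H _]] | i d u x A t [p [H _]]
    | i d e u v x y P [p [H _]] | i p q d e _ H | i d e [p [H _]]]; congruence.
Qed.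

(** As [cut_at] is not decided, the induction runs from the end of the branch: once all later
    indices are excluded, a cut at [i] would be the head-cut. *)
Lemma no_head_cut (D : tree) (a : list position) :
  ~ has_head_cut D a -> forall i, ~ cut_at D a i.
Proof.
  intros Hh.
  enough (H : forall n i, length a - i <= n -> ~ cut_at D a i) by eauto.
  induction n as [| n IH]; intros i Hi Hc; pose proof (cut_at_bound _ _ _ Hc).
  - lia.
  - apply Hh; exists i; split; [exact Hc |].
    intros j Hj; destruct (le_gt_dec j i) as [| Hij]; [assumption |].
    destruct (IH j); [lia | exact Hj].
Qed.

Definition head_normal (D : tree) : Prop :=
  forall a, principal_branch D a ->
    (forall i, ~ cut_at D a i) /\ ~ branch_has_nonnormal_term D a.

Lemma derivation_subderivation (R : atomic_rules) (D : tree) (p : position) (d : tree) :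
  derivation R D -> subderivation D p = Some d -> derivation R d.
Proof.
  revert D; induction p as [| k p IH]; intros D HD; simpl.
  - intros [= <-]; exact HD.
  - destruct (nth_error (premisses D) k) as [e |] eqn:He; [| discriminate].
    apply IH; destruct HD as [r C ps Hps _ _ _].
    apply Hps; eapply nth_error_In; exact He.
Qed.

(** Cuts are defined along complete branches; completing a path above [q] lets a configuration found
    there be confronted with [head_normal]. *)
Lemma principal_branch_through (R : atomic_rules) (D : tree) (q : position) (d : tree) :
  derivation R D -> principal_path D q -> subderivation D q = Some d ->
  exists r, principal_branch D (descent (q ++ r)).
Proof.
  intros HD Hq Hd.
  destruct (principal_top R D d (derivation_subderivation _ _ _ _ HD Hd) q Hq Hd)
    as (r & e & H1 & H2 & H3).
  exists r; eapply principal_branch_descent; eauto.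
Qed.

Lemma occ_descent (D : tree) (q r : position) (d : tree) (i : nat) :
  subderivation D q = Some d -> i = length r -> occ D (descent (q ++ r)) i d.
Proof. intros Hd ->; exists q; split; [apply nth_error_descent_app | exact Hd]. Qed.

Lemma head_normal_root (R : atomic_rules) (D : tree) (q : position) (d : tree) :
  derivation R D -> head_normal D -> principal_path D q ->
  subderivation D q = Some d -> ~ nonnormal_at_root d.
Proof.
  intros HD HN Hq Hd Hn.
  destruct (principal_branch_through _ _ _ _ HD Hq Hd) as [r Hr].
  destruct (HN _ Hr) as [_ H]; apply H.
  exists (length r), d; split; [apply occ_descent; auto | exact Hn].
Qed.

(** The main term counts as occurring in the conclusion, so it is normal; being closed too, it is
    zero or a successor, as [cut_ind] asks. *)
Lemma head_normal_Ind (R : atomic_rules) (D : tree) (q : position) (d : tree) u x A t :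
  derivation R D -> head_normal D -> principal_path D q ->
  subderivation D q = Some d -> root_rule d = Ind u x A t ->
  (forall z, ~ toccurs z t) -> False.
Proof.
  intros HD HN Hq Hd Hr Ht.
  assert (Hn : tnormal t).
  { intros t' Ht'.
    apply (head_normal_root _ _ _ _ HD HN Hq Hd).
    right; exists t; unfold main_term; rewrite Hr; split; [reflexivity |].
    intros Hn; exact (Hn _ Ht'). }
  destruct (principal_branch_through _ _ _ _ HD Hq Hd) as [r Hb].
  destruct (HN _ Hb) as [H _]; apply (H (length r)).
  eapply cut_ind; [apply occ_descent; eauto | exact Hr |].
  now apply closed_normal_term.
Qed.

Lemma head_normal_detour (R : atomic_rules) (D : tree) (q : position) (d e : tree) :
  derivation R D -> head_normal D -> principal_path D q ->
  subderivation D q = Some d -> nth_error (premisses d) 0 = Some e ->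
  is_elim (root_rule d) -> is_intro (root_rule e) ->
  (root_rule e = AndI ->
     exists k f, nth_error (premisses e) k = Some f /\ concl f ≡ concl d) ->
  False.
Proof.
  intros HD HN Hq Hd He Hel Hin Hand.
  assert (Hq' : principal_path D (q ++ [0])) by (eapply principal_path_snoc; eauto).
  assert (He' := subderivation_snoc _ _ _ _ _ Hd He).
  assert (Hex : root_rule e = AndI \/ root_rule e <> AndI)
    by (destruct (root_rule e); (left; reflexivity) || (right; discriminate)).
  destruct Hex as [Hai | Hai].
  - destruct (Hand Hai) as (k & f & Hf & Hfd).
    (* The branch must come from the conjunct that the elimination selects, so the path enters
       premiss [k]; [AndI] puts no constraint on principality. *)
    assert (Hq'' : principal_path D ((q ++ [0]) ++ [k])).
    { eapply principal_path_snoc; eauto; rewrite Hai; simpl; tauto. }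
    assert (Hf' := subderivation_snoc _ _ _ _ _ He' Hf).
    destruct (principal_branch_through _ _ _ _ HD Hq'' Hf') as [r Hb].
    (* Counted from the top, [f], [e] and [d] have the indices [length r], [S (length r)] and
       [S (S (length r))]. *)
    destruct (HN _ Hb) as [H _]; apply (H (S (S (length r)))).
    eapply cut_detour with (d := d) (e := e); auto.
    + rewrite <- !app_assoc; now apply occ_descent.
    + rewrite <- app_assoc; now apply occ_descent.
    + intros _; exists (length r), f; repeat split; auto.
      now apply occ_descent.
  - destruct (principal_branch_through _ _ _ _ HD Hq' He') as [r Hb].
    destruct (HN _ Hb) as [H _]; apply (H (S (length r))).
    eapply cut_detour with (d := d) (e := e); auto.
    + rewrite <- app_assoc; now apply occ_descent.
    + now apply occ_descent.
    + contradiction.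
Qed.

Lemma head_normal_permute (R : atomic_rules) (D : tree) (q : position) (d e : tree) :
  derivation R D -> head_normal D -> principal_path D q ->
  subderivation D q = Some d -> nth_error (premisses d) 0 = Some e ->
  is_elim (root_rule d) -> ~ is_EM1 (root_rule e).
Proof.
  intros HD HN Hq Hd He Hel Hem.
  assert (Hq' : principal_path D (q ++ [0])) by (eapply principal_path_snoc; eauto).
  assert (He' := subderivation_snoc _ _ _ _ _ Hd He).
  destruct (principal_branch_through _ _ _ _ HD Hq' He') as [r Hb].
  destruct (HN _ Hb) as [H _]; apply (H (S (length r))).
  eapply cut_EM1_permute with (d := d) (e := e); auto.
  - rewrite <- app_assoc; now apply occ_descent.
  - now apply occ_descent.
Qed.

Lemma head_normal_unused (R : atomic_rules) (D : tree) (q : position) (d e : tree)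
    u v x y P :
  derivation R D -> head_normal D -> principal_path D q ->
  subderivation D q = Some d -> nth_error (premisses d) 0 = Some e ->
  root_rule d = EM1 u v x y P -> (forall B, ~ open_assumption e u B) -> False.
Proof.
  intros HD HN Hq Hd He Hr Ho.
  assert (Hq' : principal_path D (q ++ [0])) by (eapply principal_path_snoc; eauto).
  assert (He' := subderivation_snoc _ _ _ _ _ Hd He).
  destruct (principal_branch_through _ _ _ _ HD Hq' He') as [r Hb].
  destruct (HN _ Hb) as [H _]; apply (H (S (length r))).
  eapply cut_EM1_unused with (d := d) (e := e); eauto.
  - rewrite <- app_assoc; now apply occ_descent.
  - now apply occ_descent.
Qed.

(** The branch starts at the assumption, so its occurrence 1 is the conclusion of [d], and
    [S (length q1)] is the index of the EM1 instance at [q0]. *)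
Lemma head_normal_closed_instance (D : tree) (q : position) (d e f : tree)
    (q0 q1 : position) u B :
  head_normal D -> principal_path D (q ++ [0]) ->
  subderivation D q = Some d -> is_atomic (concl d) -> closed_formula (concl d) ->
  subderivation D (q ++ [0]) = Some (Node (Assume u) B []) ->
  q ++ [0] = q0 ++ 0 :: q1 -> subderivation D q0 = Some f ->
  is_EM1 (root_rule f) -> discharged_by D (q ++ [0]) q0 0 -> False.
Proof.
  intros HN Hq Hd Hat Hcl He Heq Hf Hem Hdis.
  assert (Hb : principal_branch D (descent (q ++ [0]))).
  { eapply principal_branch_descent; eauto.
    split; [reflexivity | right; exists u; reflexivity]. }
  destruct (HN _ Hb) as [H _]; apply (H (S (length q1))).
  eapply cut_EM1_closed with (p := q ++ [0]) (q := q0) (e := d); eauto.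
  - apply nth_error_descent; exists []; rewrite app_nil_r; auto.
  - rewrite Heq; exact (nth_error_descent_app q0 (0 :: q1)).
  - now apply occ_descent.
Qed.

(** * Closed occurrences depending only on universal assumptions *)

(** The invariant of the ascent. The last field keeps, for each open label, the EM1 instance below
    that discharges it, with no discharge in between; at an assumption this is what [discharged_by]
    asks. *)
Record reached (D : tree) (q : position) (d : tree) : Prop := {
  reached_at : subderivation D q = Some d;
  reached_principal : principal_path D q;
  reached_closed : forall z, ~ free_in_derivation z d;
  reached_open : forall u B, open_assumption d u B ->
    shape_of B = SAll SAtom /\
    exists q0 q1 f, q = q0 ++ 0 :: q1 /\ subderivation D q0 = Some f /\
      is_EM1 (root_rule f) /\ discharges (root_rule f) 0 u /\
      forall p1 j p2 e, q1 = p1 ++ j :: p2 ->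
        subderivation D (q0 ++ 0 :: p1) = Some e -> ~ discharges (root_rule e) j u
}.

Lemma discharges_dec (r : rule) (k u : nat) : discharges r k u \/ ~ discharges r k u.
Proof.
  unfold discharges; destruct (discharge r k) as [[v A] |].
  - destruct (Nat.eq_dec v u) as [-> | Hne]; [left; eauto |].
    right; intros [B HB]; congruence.
  - right; intros [B HB]; discriminate.
Qed.

(** Nothing is bound in premiss [k], so closedness passes upwards. A newly open assumption is
    discharged by the EM1 instance [d] itself and is universal by [discharge_ok]; for any other, the
    path from its EM1 instance grows by one step. *)
Lemma reached_premiss (R : atomic_rules) (D : tree) (q : position) (d e : tree) (k : nat) :
  derivation R D -> reached D q d -> nth_error (premisses d) k = Some e ->
  (is_elim (root_rule d) \/ is_EM1 (root_rule d) -> k = 0) ->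
  (forall z, ~ binds (root_rule d) k z) ->
  (forall u, discharges (root_rule d) k u -> is_EM1 (root_rule d) /\ k = 0) ->
  reached D (q ++ [k]) e.
Proof.
  intros HD [Hd Hq Hc Ho] He Hk Hb Hdis.
  assert (Hder := derivation_subderivation _ _ _ _ HD Hd).
  constructor.
  - eapply subderivation_snoc; eauto.
  - eapply principal_path_snoc; eauto.
  - intros z Hz; apply (Hc z); destruct d as [r C ps].
    eapply free_premiss; eauto; apply Hb.
  - intros u B HB.
    destruct (discharges_dec (root_rule d) k u) as [Hu | Hu].
    + destruct (Hdis u Hu) as [Hem ->].
      split.
      * destruct Hder as [r C ps _ _ _ Hok]; destruct Hu as [A HA].
        rewrite (shape_same_nf _ _ _ (Hok _ _ _ _ _ He HA HB)).
        destruct r; try contradiction; simpl in HA; injection HA as _ <-.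
        reflexivity.
      * exists q, [], d; repeat split; auto.
        intros p1 j p2 e' Heq; destruct p1; discriminate.
    + destruct (Ho u B) as (HS & q0 & q1 & f & -> & Hf & Hem & Hu0 & Hnd).
      { destruct d as [r C ps]; eapply open_premiss; eauto. }
      split; [exact HS |].
      exists q0, (q1 ++ [k]), f; rewrite <- app_assoc; repeat split; auto.
      intros p1 j p2 e' Heq He'.
      apply snoc_eq_app_cons in Heq as [(-> & -> & ->) | (r' & -> & ->)].
      * rewrite Hd in He'; injection He' as <-; exact Hu.
      * eapply Hnd; eauto.
Qed.

Lemma reached_Ind (R : atomic_rules) (D : tree) (q : position) (d : tree) u x A t :
  derivation R D -> head_normal D -> reached D q d -> root_rule d <> Ind u x A t.
Proof.
  intros HD HN [Hd Hq Hc _] Hr.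
  eapply head_normal_Ind; eauto.
  intros z Hz; apply (Hc z), free_root; right.
  exists t; unfold main_term; rewrite Hr; auto.
Qed.

(** * Which rules can end a reached occurrence *)

Lemma shape_Atomic (R : atomic_rules) ps C :
  rule_instance R Atomic ps C ->
  shape_of C = SAtom /\ Forall (fun A => shape_of A = SAtom) ps.
Proof.
  intros (Ps & P & _ & Hps & HC); split; [exact (shape_same_nf _ _ _ HC) |].
  clear HC; remember (map Atom Ps) as l eqn:Hl; revert Ps Hl.
  induction Hps as [| A B ps l HAB _ IH]; intros [| Q Ps] Hl; try discriminate;
    constructor; injection Hl as HB Hl; eauto.
  subst B; exact (shape_same_nf _ _ _ HAB).
Qed.

Ltac shapes :=
  repeat match goal with
  | H : _ /\ _ |- _ => destruct H
  | H : exists _, _ |- _ => destruct H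
  | H : _ ≡ _ |- _ => apply shape_same_nf in H; simpl in H
  end;
  unfold forall_, exists_ in *; simpl in *;
  rewrite ?shape_sub, ?shape_abstract in *.

(** The last clause serves universal assumptions: such a major premiss forces [AllE], and an
    instance of an atomic formula is atomic. *)
Lemma elim_major (R : atomic_rules) r ps C :
  is_elim r -> rule_instance R r ps C ->
  exists A ps', ps = A :: ps' /\ shape_of A <> SAtom /\
    (shape_of A = SAll SAtom -> shape_of C = SAtom).
Proof.
  destruct r; simpl; try contradiction; intros _;
    destruct ps as [| A0 [| A1 [| A2 [| A3 ps]]]]; try contradiction;
    intros H; shapes; eexists; eexists; (split; [reflexivity |]);
    split; intros; congruence.
Qed.

(** Supplies the side condition of [cut_detour]: normality of the major premiss identifies the
    introduced conjunction with the eliminated one. *)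
Lemma AndI_elim_component (R : atomic_rules) r psd A e :
  derivation R e -> ~ has_nonnormal_term (concl e) ->
  is_elim r -> rule_instance R r (concl e :: psd) A -> root_rule e = AndI ->
  exists k f, nth_error (premisses e) k = Some f /\ concl f ≡ A.
Proof.
  intros He Hn Hel Hr Hai.
  destruct He as [r' C ps _ Hri _ _]; simpl in *; subst r'.
  destruct ps as [| f0 [| f1 [| f2 ps]]]; simpl in Hri; try contradiction.
  destruct r; simpl in Hel, Hr; try contradiction;
    destruct psd as [| A1 [| A2 [| A3 psd]]]; try contradiction.
  1: { destruct Hr as [B HB]; exists 0, f0; split; [reflexivity |].
       apply (same_nf_And_inv _ _ _ _ _ _ Hn Hri HB). }
  1: { destruct Hr as [B HB]; exists 1, f1; split; [reflexivity |].
       apply (same_nf_And_inv _ _ _ _ _ _ Hn Hri HB). }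
  all: exfalso; shapes; congruence.
Qed.

(** By induction the major premiss is not itself an elimination, so a chain of eliminations is
    examined only at its top. *)
Lemma reached_not_elim (R : atomic_rules) (D d : tree) :
  derivation R D -> head_normal D -> derivation R d ->
  forall q, reached D q d -> ~ is_elim (root_rule d).
Proof.
  intros HD HN.
  induction 1 as [r C ps Hps IH Hr Heig Hok]; intros q Hq Hel; simpl in Hel.
  destruct (elim_major _ _ _ _ Hel Hr) as (A & As & Heq & HA & HC).
  destruct ps as [| e ps]; [discriminate |].
  injection Heq as HeA HAs; subst A.
  assert (He : nth_error (premisses (Node r C (e :: ps))) 0 = Some e) by reflexivity.
  assert (Hder := Hps e (or_introl eq_refl)).
  assert (Hq' : reached D (q ++ [0]) e).
  { eapply reached_premiss; eauto; simpl.
    - intros z; destruct r; simpl in *; tauto.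
    - intros u [B HB]; destruct r; simpl in *; try contradiction; discriminate. }
  assert (Hnot : ~ is_elim (root_rule e)) by (eapply IH; [left |]; eauto).
  assert (Hin : ~ is_intro (root_rule e)).
  { intros Hin; eapply head_normal_detour with (D := D) (q := q)
      (d := Node r C (e :: ps)) (e := e);
      eauto using reached_at, reached_principal.
    intros Hai; eapply AndI_elim_component; eauto.
    intros Hn; eapply head_normal_root with (D := D) (q := q ++ [0]);
      eauto using reached_at, reached_principal.
    left; exact Hn. }
  assert (Hem : ~ is_EM1 (root_rule e)).
  { eapply head_normal_permute with (D := D) (q := q) (d := Node r C (e :: ps));
      eauto using reached_at, reached_principal. }
  (* Only an assumption, an atomic rule and [Ind] remain as origin of the major premiss. *)
  destruct (root_rule e) eqn:Hre; simpl in *; try tauto.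
  - destruct Hder as [r' B ps' _ Hri _ _]; simpl in *; subst r'.
    destruct ps' as [| e' ps']; [| contradiction].
    destruct (reached_open _ _ _ Hq' _ _ (open_leaf _ _))
      as (HB & q0 & q1 & f & Heq & Hf & Hfem & Hu & Hnd).
    (* The assumption is universal, so [C] is an instance of its atomic body; [C] is closed because
       [e] and hence [d] lie within the invariant. *)
    eapply head_normal_closed_instance with (D := D) (q := q)
        (d := Node r C (Node (Assume u) B [] :: ps));
      eauto using reached_at, reached_principal.
    + apply shape_atomic; auto.
    + intros z Hz; apply (reached_closed _ _ _ Hq z), free_root; left; exact Hz.
    + exists u, B, f, q1; repeat split; eauto using reached_at.
  - destruct Hder as [r' B ps' _ Hri _ _]; simpl in *; subst r'.
    apply HA; eapply shape_Atomic; eauto.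
  - exact (reached_Ind _ _ _ _ _ _ _ _ HD HN Hq' Hre).
Qed.

(** The absence of open assumptions is part of the induction because it refutes EM1: the left
    premiss has the shape of the conclusion, so it would not use the universal assumption, giving
    [cut_EM1_unused]. *)
Lemma reached_simple (R : atomic_rules) (D d : tree) :
  derivation R D -> head_normal D -> derivation R d ->
  forall q, reached D q d ->
  shape_of (concl d) = SAtom \/ shape_of (concl d) = SEx SAtom ->
  (forall u B, ~ open_assumption d u B) /\
  (atomic_derivation d \/ root_rule d = ExI).
Proof.
  intros HD HN Hd.
  induction Hd as [r C ps Hps IH Hr Heig Hok]; intros q Hq HC; simpl in HC.
  assert (Hdd : derivation R (Node r C ps)) by (constructor; assumption).
  assert (Hne := reached_not_elim _ _ _ HD HN Hdd q Hq).
  destruct r; simpl in Hne; try tauto.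
  (* By the invariant an assumption would be universal, against [HC]. *)
  - exfalso; destruct ps; [| contradiction].
    destruct (reached_open _ _ _ Hq _ _ (open_leaf _ _)) as [HB _].
    destruct HC; congruence.
  - destruct (shape_Atomic _ _ _ Hr) as [HC' Hps'].
    assert (Hall : forall k d, nth_error ps k = Some d ->
      (forall u B, ~ open_assumption d u B) /\ atomic_derivation d).
    { intros k d Hk.
      assert (Hin := nth_error_In _ _ Hk).
      assert (Hat : shape_of (concl d) = SAtom).
      { rewrite Forall_forall in Hps'; apply Hps', in_map, Hin. }
      destruct (IH d Hin (q ++ [k])) as [Ho [Ha | Hex]]; auto.
      - eapply reached_premiss; eauto; simpl; try tauto.
        intros u [B HB]; discriminate.
      - exfalso; destruct (Hps d Hin) as [r' A ps' _ Hri _ _].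
        simpl in *; subst r'.
        destruct ps' as [| d0 [| d1 ps']]; simpl in Hri; try contradiction.
        shapes; congruence. }
    split.
    + intros u B HB; inversion HB; subst.
      eapply Hall; eauto.
    + left; intros [| k p] e; simpl.
      * intros [= <-]; apply shape_atomic, HC'.
      * destruct (nth_error ps k) as [d |] eqn:Hk; [| discriminate].
        apply (Hall k d Hk).
  - exfalso; destruct ps as [| d0 [| d1 [| d2 ps]]]; simpl in Hr; try contradiction.
    shapes; destruct HC; congruence.
  - exfalso; destruct ps as [| d0 [| d1 ps]]; simpl in Hr; try contradiction.
    shapes; destruct HC; congruence.
  - exfalso; destruct ps as [| d0 [| d1 ps]]; simpl in Hr; try contradiction.
    shapes; destruct HC; congruence.
  - exfalso; destruct ps as [| d0 [| d1 ps]]; simpl in Hr; try contradiction.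
    shapes; destruct HC; congruence.
  - exfalso; destruct ps as [| d0 [| d1 ps]]; simpl in Hr; try contradiction.
    shapes; destruct HC; congruence.
  - split; [| right; reflexivity].
    destruct ps as [| d [| d1 ps]]; simpl in Hr; try contradiction.
    assert (Ho : forall u B, ~ open_assumption d u B).
    { eapply IH; [left; reflexivity | |].
      - eapply reached_premiss with (k := 0); eauto; simpl; try tauto.
        intros u [B HB]; discriminate.
      (* [C] is simply existential in shape, so the premiss, an instance of its body, is atomic. *)
      - left; shapes; destruct HC; congruence. }
    intros u B HB; inversion HB; subst.
    match goal with H : nth_error [d] ?k = Some _ |- _ =>
      apply nth_error_In in H as [<- | []] end.
    eapply Ho; eauto.
  - exfalso; exact (reached_Ind _ _ _ _ _ _ _ _ HD HN Hq eq_refl).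
  - exfalso; destruct ps as [| d [| d1 [| d2 ps]]]; simpl in Hr; try contradiction.
    eapply head_normal_unused with (D := D) (q := q) (e := d);
      eauto using reached_at, reached_principal; [reflexivity.. |].
    eapply IH; [left; reflexivity | |].
    + eapply reached_premiss with (k := 0); eauto; simpl; auto.
    + shapes; destruct HC; [left | right]; congruence.
Qed.

Theorem theorem1 (R : atomic_rules) (HR : admissible_rules R)
  (D : tree) (A : formula nat)
  (HD : derivation R D) (HA : concl D = A)
  (Hnormal : forall a, principal_branch D a ->
     ~ has_head_cut D a /\ ~ branch_has_nonnormal_term D a)
  (Hvars : forall z, ~ free_in_derivation z D)
  (Hopen : forall u B, ~ open_assumption D u B) :
  (simple A -> atomic_derivation D \/ root_rule D = ExI) /\
  (simply_existential A -> is_intro (root_rule D)).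
Proof.
  assert (HN : head_normal D).
  { intros a Ha; destruct (Hnormal a Ha) as [Hh Hn].
    split; [now apply no_head_cut | exact Hn]. }
  (* At the root the path is empty and no assumption is open, so principality and the last field
     hold vacuously. *)
  assert (HD0 : reached D [] D).
  { constructor; auto.
    - intros [| j q] k r d Heq; discriminate.
    - intros u B HB; destruct (Hopen u B HB). }
  assert (Hmain := reached_simple _ _ _ HD HN HD [] HD0).
  rewrite HA in Hmain; split.
  - intros [_ [[P ->] | [P ->]]]; apply Hmain; simpl; auto.
  - intros [P ->].
    destruct Hmain as [_ [Hat | ->]]; [simpl; auto | | exact I].
    destruct (Hat [] D eq_refl) as [Q HQ]; congruence.
Qed.
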